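(* Let $E$ be a finite-dimensional vector space over a field and let $\mathcal{I}$ be a collection of subspaces of $E$ satisfying (I1), (I2), (I3). Then the following are equivalent: (a) $\mathcal{I}$ satisfies (I4); (b) $\mathcal{I}$ satisfies (I4'); (c) $\mathcal{I}$ satisfies (I4''). Here: (I1) $\mathcal{I}\neq\emptyset$. (I2) If $J\in\mathcal{I}$ and $I\subseteq J$ is a subspace, then $I\in\mathcal{I}$. (I3) For all $I,J\in\mathcal{I}$ with $\dim I<\dim J$ there is a $1$-dimensional subspace $x\subseteq J$, $x\not\subseteq I$, with $I+x\in\mathcal{I}$. (I4) For all subspaces $A,B$ of $E$ and all $I\in\max(\mathcal{I}\cap\mathcal{L}(A))$, $J\in\max(\mathcal{I}\cap\mathcal{L}(B))$, there exists $K\in\max(\mathcal{I}\cap\mathcal{L}(A+B))$ with $K\subseteq I+J$. (I4') For all subspaces $A,B$ of $E$ and all $I\in\max(A,\mathcal{I})$ there exists $J\in\max(A+B,\mathcal{I})$ with $J\subseteq I+B$. (I4'') For every subspace $A$ of $E$, every $I\in\max(A,\mathcal{I})$ and every $1$-dimensional subspace $x$ of $E$, there exists $J\in\max(x+A,\mathcal{I})$ with $J\subseteq x+I$.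
   Context: $\mathcal{L}(E)$ denotes the lattice of subspaces of $E$ and, for a subspace $A$, $\mathcal{L}(A)$ the set of subspaces of $A$. For a collection $\mathcal{A}$ of subspaces, $\max(\mathcal{A})$ is the set of members of $\mathcal{A}$ not properly contained in any other member of $\mathcal{A}$. For a subspace $X$, $\max(X,\mathcal{A})$ is the set of $A\in\mathcal{A}$ with $A\subseteq X$ such that $\dim A\ge \dim B$ for every $B\in\mathcal{A}$ with $B\subseteq X$. *)

(* Defs.v *)
From mathcomp Require Import all_boot all_algebra.
From mathcomp Require Export classical_sets.

Set Implicit Arguments.
Unset Strict Implicit.
Unset Printing Implicit Defensive.

Local Open Scope classical_set_scope.

Section SubspaceCollections.
Variables (F : fieldType) (E : vectType F).
Implicit Types (A B I J K X x : {vspace E}) (S : set {vspace E}).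

Definition subspaces_of A : set {vspace E} := [set B | (B <= A)%VS].

(* Maximality for inclusion, [max(S)]; compare [max_dim_in]. *)
Definition max_incl S : set {vspace E} :=
  [set A | S A /\ forall B, S B -> ~~ ((A <= B)%VS && (A != B))].

(* Maximality for dimension among the members of S inside X, [max(X, S)]. *)
Definition max_dim_in X S : set {vspace E} :=
  [set A | [/\ S A, (A <= X)%VS &
             forall B, S B -> (B <= X)%VS -> \dim B <= \dim A]].

Definition I1 S : Prop := S !=set0.

Definition I2 S : Prop := forall I J, S J -> (I <= J)%VS -> S I.

Definition I3 S : Prop :=
  forall I J, S I -> S J -> \dim I < \dim J ->
    exists x, [/\ \dim x = 1, (x <= J)%VS, ~~ (x <= I)%VS & S (I + x)%VS].

Definition I4 S : Prop :=
  forall A B I J,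
    max_incl (S `&` subspaces_of A) I -> max_incl (S `&` subspaces_of B) J ->
    exists2 K, max_incl (S `&` subspaces_of (A + B)) K & (K <= I + J)%VS.

Definition I4' S : Prop :=
  forall A B I, max_dim_in A S I ->
    exists2 J, max_dim_in (A + B) S J & (J <= I + B)%VS.

Definition I4'' S : Prop :=
  forall A I x, max_dim_in A S I -> \dim x = 1 ->
    exists2 J, max_dim_in (x + A) S J & (J <= x + I)%VS.

End SubspaceCollections.

(* Main.v *)
Require Import Defs.
From mathcomp Require Import all_boot all_algebra.
From mathcomp Require Import boolp.

Set Implicit Arguments.
Unset Strict Implicit.
Unset Printing Implicit Defensive.

(** By (I3), inclusion-maximal and dimension-maximal members of [S] inside a
subspace coincide. Adjoining a line [x] at a time, (I4'') then yields (I4') by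
induction on a spanning sequence of [B], and two uses of (I4') yield (I4): first
a maximal member of [A + B] inside [I + B], then one of [B + I] inside [J + I],
which has the same dimension. *)

Section Maximality.
Variables (F : fieldType) (E : vectType F) (S : set {vspace E}).
Implicit Types A B I J K : {vspace E}.

(** By (I1) and (I2) the zero subspace is a member, and [\dim A] bounds the dimensions, so a largest
    one is attained. *)
Lemma max_dim_in_exists A : I1 S -> I2 S -> exists I, max_dim_in A S I.
Proof.
move=> [J0 SJ0] hI2.
pose P n := `[< exists I, [/\ S I, (I <= A)%VS & \dim I = n] >].
have exP : exists n, P n.
  exists 0; apply/asboolP; exists 0%VS.
  by rewrite dimv0 sub0v; split=> //; apply: hI2 SJ0 (sub0v _).
have ubP n : P n -> n <= \dim A.
  by move=> /asboolP[I [_ IA <-]]; apply: dimvS.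
have [n /asboolP[I [SI IA <-]] maxI] := ex_maxnP exP ubP.
by exists I; split=> // B SB BA; apply: maxI; apply/asboolP; exists B.
Qed.

Lemma max_dim_in_incl A I :
  max_dim_in A S I -> max_incl (S `&` subspaces_of A)%classic I.
Proof.
move=> [SI IA maxI]; split=> // B [SB BA]; apply/negP => /andP[IB] /negP[].
by rewrite eqEdim IB maxI.
Qed.

(** If some [B] in [S] inside [A] had larger dimension, (I3) would enlarge [I] by a line of [B],
    still inside [A]. *)
Lemma max_incl_dim_in A I : I3 S ->
  max_incl (S `&` subspaces_of A)%classic I -> max_dim_in A S I.
Proof.
move=> hI3 [[SI IA] maxI]; split=> // B SB BA; rewrite leqNgt; apply/negP => ltIB.
have [x [_ xB xI SIx]] := hI3 _ _ SI SB ltIB.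
have IxA : (I + x <= A)%VS by rewrite subv_add IA (subv_trans xB BA).
move: (maxI _ (conj SIx IxA)); rewrite addvSl /= negbK => /eqP eqI.
by move: xI; rewrite eqI addvSr.
Qed.

(** [I] is itself a competitor inside [A], so [\dim K] reaches the largest dimension available in
    [B]. *)
Lemma max_dim_in_sub A B I K :
  (A <= B)%VS -> max_dim_in B S I -> (I <= A)%VS -> max_dim_in A S K ->
  max_dim_in B S K.
Proof.
move=> AB [SI _ maxI] IA [SK KA maxK]; split=> //; first exact: subv_trans KA AB.
by move=> C SC CB; apply: leq_trans (maxI _ SC CB) (maxK _ SI IA).
Qed.

Lemma I4''_I4' : I4'' S -> I4' S.
Proof.
move=> h A B I maxI; rewrite -(span_basis (vbasisP B)).
elim: (tval (vbasis B)) => [|v s [J maxJ JI]].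
  by exists I; rewrite span_nil !addv0.
(* The induction forgets that the sequence is a basis, so [v] may be zero; it then spans no line,
   but adds nothing to the span either. *)
have [->|v0] := eqVneq v 0%R.
  have s0 : (<[0]> <= <<s>>)%VS by rewrite -memvE mem0v.
  by exists J; rewrite span_cons (addv_idPr s0).
have [|K maxK KJ] := h _ _ <[v]>%VS maxJ; first by rewrite dim_vline v0.
have swap U : (<[v]> + (U + <<s>>) = U + <<v :: s>>)%VS.
  by rewrite span_cons !addvA (addvC U).
exists K; first by rewrite -swap.
by rewrite -swap; apply: subv_trans KJ _; apply: addvS.
Qed.

Lemma I4'_I4 : I3 S -> I4' S -> I4 S.
Proof.
move=> hI3 h A B I J /(max_incl_dim_in hI3) maxI /(max_incl_dim_in hI3) maxJ.
have [L maxL LIB] := h A B I maxI.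
have [K maxK KJI] := h B I J maxJ.
exists K; last by rewrite addvC.
apply: max_dim_in_incl; rewrite addvC in maxK.
have [_ IA _] := maxI.
by apply: max_dim_in_sub maxL LIB maxK; apply: addvS.
Qed.

End Maximality.

Theorem theorem23 (F : fieldType) (E : vectType F) (S : set {vspace E})
    (hI1 : I1 S) (hI2 : I2 S) (hI3 : I3 S) :
  [<-> I4 S; I4' S; I4'' S].
Proof.
tfae.
(* Any maximal [J] in [B] can be paired with [I] in (I4), since [I + J] lies in [I + B]. *)
- move=> h A B I maxI; have [J maxJ] := max_dim_in_exists B hI1 hI2.
  have [K maxK KIJ] := h _ _ _ _ (max_dim_in_incl maxI) (max_dim_in_incl maxJ).
  exists K; first exact: max_incl_dim_in.
  by have [_ JB _] := maxJ; apply: subv_trans KIJ _; apply: addvS.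
- move=> h A I x maxI _; have [J maxJ JIx] := h A x I maxI.
  by exists J; rewrite addvC.
- by move=> h; apply: I4'_I4 => //; apply: I4''_I4'.
Qed.
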